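(* Let $d\ge1$ and let $M\in\mathrm{Mat}(d,\mathbb{Z})$ with $D:=\det(M)\ne0$. Then the rational function $\widetilde{\zeta}_M$ satisfies $$\widetilde{\zeta}_M\Bigl(\frac{1}{Dz}\Bigr)=B\,\bigl(\widetilde{\zeta}_M(z)\bigr)^{(-1)^d},$$ where $B=D$ for $d=1$ and $B=1$ otherwise.
   Context: For $M\in\mathrm{Mat}(d,\mathbb{Z})$, put $\widetilde{a}_m:=\det(\mathbb{1}-M^m)$ for $m\ge1$, with $\mathbb{1}$ the identity matrix, and $\widetilde{\zeta}_M(z):=\exp\bigl(\sum_{m=1}^{\infty}\frac{\widetilde{a}_m}{m}z^m\bigr)$. This power series is the expansion at $0$ of the rational function $\prod_{k=0}^{d}\det\bigl(\mathbb{1}-z\bigwedge^k(M)\bigr)^{(-1)^{k+1}}$, also denoted $\widetilde{\zeta}_M(z)$, where $\bigwedge^k(M)$ is the linear map induced by $M$ on the exterior power $\bigwedge^k(\mathbb{R}^d)$ (with $\bigwedge^0(M)=1$). *)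

(* Defs.v *)
From HB Require Import structures.
From mathcomp Require Import all_boot all_order all_algebra.
From mathcomp Require Import perm generic_quotient.

Set Implicit Arguments.
Unset Strict Implicit.
Unset Printing Implicit Defensive.

Import Order.TTheory GRing.Theory Num.Theory.
Local Open Scope ring_scope.

Notation tofrac := (@FracField.tofrac _).

Section ExteriorPower.

Variable R : comNzRingType.

(* The strictly increasing k-tuples i_1 < ... < i_k in 'I_d; such a tuple      *)
(* indexes the vector e_(i_1) /\ ... /\ e_(i_k) of the standard basis of the   *)
(* k-th exterior power of R^d. For k = 0 there is exactly one such tuple.      *)
Definition incr_tuples (d k : nat) : {set k.-tuple 'I_d} :=
  [set t : k.-tuple 'I_d | sorted ltn (map val t)].

Definition incr_tuple (d k : nat) (I : 'I_#|incr_tuples d k|) : 'I_k -> 'I_d :=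
  tnth (enum_val I).

(* The coordinates of v_1 /\ ... /\ v_k in the standard basis, where v_i is    *)
(* the i-th row of V.                                                          *)
Definition wedge (d k : nat) (V : 'M[R]_(k, d)) : 'rV[R]_#|incr_tuples d k| :=
  \row_J \det (mxsub id (incr_tuple J) V).

(* The matrix, in the standard bases, of the map induced by A on the k-th      *)
(* exterior power: the (I, J) entry is the minor of A with rows I and columns  *)
(* J. It sends v_1 /\ ... /\ v_k to (v_1 A) /\ ... /\ (v_k A): see             *)
(* wedge_mulmx. The same minors arise when A acts on columns instead of rows.  *)
Definition ext_power (d k : nat) (A : 'M[R]_d) : 'M[R]_#|incr_tuples d k| :=
  \matrix_(I, J) \det (mxsub (incr_tuple I) (incr_tuple J) A).

Lemma det_mulmx_rect (k d : nat) (V : 'M[R]_(k, d)) (W : 'M[R]_(d, k)) :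
  \det (V *m W) =
  \sum_(f : {ffun 'I_k -> 'I_d}) (\prod_i V i (f i)) * \det (mxsub f id W).
Proof.
pose AB (s : 'S_k) i j := V i j * W j (s i).
transitivity (\sum_(f : {ffun 'I_k -> 'I_d}) \sum_(s : 'S_k)
                (-1) ^+ s * \prod_i AB s i (f i)).
  rewrite exchange_big; apply: eq_bigr => /= s _; rewrite -big_distrr /=.
  congr (_ * _); rewrite -(bigA_distr_bigA (AB s)) /=.
  by apply: eq_bigr => x _; rewrite mxE.
apply: eq_bigr => f _; rewrite big_distrr /=; apply: eq_bigr => s _.
rewrite big_split /= mulrCA; congr (_ * (_ * _)).
by apply: eq_bigr => x _; rewrite mxE.
Qed.

Definition sel (k d : nat) (t : k.-tuple 'I_d) (s : 'S_k) :
  {ffun 'I_k -> 'I_d} := [ffun i => tnth t (s i)].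

Definition norm_fun (k d : nat) (f : {ffun 'I_k -> 'I_d}) : k.-tuple 'I_d :=
  sort_tuple (relpre val leq) [tuple f i | i < k].

Lemma incr_tuple_uniq (k d : nat) (t : k.-tuple 'I_d) :
  t \in incr_tuples d k -> uniq t.
Proof.
rewrite inE => st; rewrite -(map_inj_uniq val_inj).
exact: (sorted_uniq ltn_trans ltnn).
Qed.

Lemma norm_fun_perm (k d : nat) (f : {ffun 'I_k -> 'I_d}) :
  perm_eq [tuple f i | i < k] (norm_fun f).
Proof. by rewrite perm_sym /norm_fun /= perm_sort. Qed.

Lemma sel_image (k d : nat) (t : k.-tuple 'I_d) : t \in incr_tuples d k ->
  [set f : {ffun 'I_k -> 'I_d} | injectiveb f & norm_fun f == t]
    = [set sel t s | s in [set: 'S_k]].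
Proof.
move=> it; have ut := incr_tuple_uniq it.
apply/setP => f; rewrite inE; apply/andP/imsetP => [[_ /eqP nf]|[s _ ->]].
  have /tuple_permP[s Es] := norm_fun_perm f.
  exists s; rewrite ?inE //; apply/ffunP => i; rewrite ffunE -nf.
  have Et : [tuple f i | i < k] = [tuple tnth (norm_fun f) (s i) | i < k].
    exact: val_inj.
  by have := congr1 (fun t => tnth t i) Et; rewrite !tnth_mktuple.
have injf : injective (sel t s).
  move=> i j; rewrite !ffunE => e; apply: (@perm_inj _ s).
  by move/tuple_uniqP: ut; apply.
split; first exact/injectiveP.
apply/eqP/val_inj/(inj_map val_inj).
apply: (@sorted_eq _ leq leq_trans anti_leq).
- rewrite sorted_map; apply: sort_sorted => x y; exact: leq_total.
- rewrite inE in it; apply: sub_sorted it => x y; exact: ltnW.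
apply: perm_map; rewrite perm_sort.
apply/tuple_permP; exists s; congr val; apply: eq_from_tnth => i.
by rewrite !tnth_mktuple ffunE.
Qed.

Lemma norm_fun_incr (k d : nat) (f : {ffun 'I_k -> 'I_d}) :
  injectiveb f -> norm_fun f \in incr_tuples d k.
Proof.
move=> /injectiveP injf; rewrite inE ltn_sorted_uniq_leq; apply/andP; split.
  rewrite (map_inj_uniq val_inj) -(perm_uniq (norm_fun_perm f)) /=.
  by rewrite map_inj_uniq ?enum_uniq.
by rewrite sorted_map; apply: sort_sorted => x y; exact: leq_total.
Qed.

Lemma wedge_mulmx (d k : nat) (V : 'M[R]_(k, d)) (A : 'M[R]_d) :
  wedge (V *m A) = wedge V *m ext_power k A.
Proof.
apply/rowP => J; rewrite !mxE; set W := mxsub id (incr_tuple J) A.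
have -> : mxsub id (incr_tuple J) (V *m A) = V *m W.
  by rewrite mulmx_colsub.
rewrite det_mulmx_rect (bigID (fun f : {ffun _} => injectiveb f)) /=.
rewrite addrC big1 ?add0r => [|f /injectivePn[i1 [i2 Di12 Ef12]]]; last first.
  rewrite [\det _](determinant_alternate Di12) ?mulr0 // => j.
  by rewrite !mxE Ef12.
rewrite (partition_big (@norm_fun k d) (mem (incr_tuples d k))) /=; last first.
  exact: norm_fun_incr.
rewrite big_enum_val /=; apply: eq_bigr => I _; rewrite !mxE.
have it := enum_valP I; set t := enum_val I in it *.
under eq_bigl => f do rewrite -(in_set (fun f : {ffun 'I_k -> 'I_d} => injectiveb f && (norm_fun f == t))).
rewrite sel_image // big_imset /=; last first.
  move=> s1 s2 _ _ /ffunP e; apply/permP => i; have := e i; rewrite !ffunE.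
  by move/tuple_uniqP: (incr_tuple_uniq it); apply.
rewrite [\det (mxsub id _ V)]/determinant mulr_suml.
apply: eq_big => [s|s _]; first by rewrite inE.
have -> : mxsub (sel t s) id W = row_perm s (mxsub (tnth t) (incr_tuple J) A).
  by apply/matrixP => i j; rewrite !mxE ffunE.
rewrite row_permE det_mulmx det_perm mulrCA mulrA; congr (_ * _ * _).
by apply: eq_bigr => i _; rewrite !mxE ffunE.
Qed.

End ExteriorPower.

Section RationalFunctions.

Variable F : fieldType.

Definition ratvar : {fraction {poly F}} := tofrac 'X.

Definition ratconst (c : F) : {fraction {poly F}} := tofrac c%:P.

HB.instance Definition _ := GRing.RMorphism.copy ratconst (tofrac \o polyC).

Definition poly_at (p : {poly F}) (g : {fraction {poly F}}) :
    {fraction {poly F}} :=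
  (map_poly ratconst p).[g].

(* f \o g, computed on a representative n/d of f. It does not depend on the    *)
(* representative when no nonzero polynomial over F vanishes at g, that is,    *)
(* when g is not constant: see ratfun_comp_frac, and poly_at_inv_var for the   *)
(* case g = 1 / (c z).                                                         *)
Definition ratfun_comp (f g : {fraction {poly F}}) : {fraction {poly F}} :=
  poly_at \n_(repr f) g / poly_at \d_(repr f) g.

Lemma tofrac_repr (f : {fraction {poly F}}) :
  f = tofrac \n_(repr f) / tofrac \d_(repr f).
Proof.
have d0 := denom_ratioP (repr f).
apply: (canRL (mulfK _)); first by rewrite tofrac_eq0.
rewrite -[f in LHS]reprK; unlock FracField.tofrac.
rewrite -[LHS]FracField.pi_mul; apply/eqmodP => /=.
rewrite FracField.equivfE /FracField.mulf /= !numden_Ratio ?mulr1 ?oner_neq0 //.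
by rewrite reprK mulrC.
Qed.

Lemma poly_atM (p q : {poly F}) (g : {fraction {poly F}}) :
  poly_at (p * q) g = poly_at p g * poly_at q g.
Proof. by rewrite /poly_at rmorphM hornerM. Qed.

Lemma ratfun_comp_frac (p q : {poly F}) (g : {fraction {poly F}}) :
    (forall r : {poly F}, r != 0 -> poly_at r g != 0) -> q != 0 ->
  ratfun_comp (tofrac p / tofrac q) g = poly_at p g / poly_at q g.
Proof.
move=> g_trans q0; rewrite /ratfun_comp.
set f := tofrac p / tofrac q.
have d0 := denom_ratioP (repr f).
apply/eqP; rewrite eqr_div ?g_trans // -!poly_atM.
suff -> : \n_(repr f) * q = p * \d_(repr f) by [].
apply/eqP; rewrite -tofrac_eq !tofracM -eqr_div ?tofrac_eq0 //.
by rewrite -tofrac_repr.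
Qed.

Lemma poly_at_inv_var (c : F) (r : {poly F}) : c != 0 -> r != 0 ->
  poly_at r (1 / (ratconst c * ratvar)) != 0.
Proof.
move=> c0 r0; pose n := (size r).-1; pose x := ratconst c * ratvar.
have x0 : x != 0 by rewrite mulf_neq0 ?tofrac_eq0 ?polyC_eq0 ?polyX_eq0.
have sr : size r = n.+1 by rewrite prednK // lt0n size_poly_eq0.
pose s : {poly F} := \sum_(i < n.+1) r`_i *: (c *: 'X) ^+ (n - i).
have Es : poly_at r (1 / x) * x ^+ n = tofrac s.
  rewrite /poly_at (@horner_coef_wide _ n.+1); last first.
    by rewrite -sr size_map_inj_poly ?rmorph0 //; apply: fmorph_inj.
  rewrite mulr_suml rmorph_sum; apply: eq_bigr => i _.
  rewrite coef_map /= -mul_polyC tofracM tofracXn -mulrA; congr (_ * _).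
  rewrite -mul_polyC tofracM -/x div1r exprVn mulrC -expfB_cond //.
  by rewrite (negPf x0) -ltnS ltn_ord.
apply/eqP => r_at; move: Es; rewrite r_at mul0r => /esym/eqP.
rewrite tofrac_eq0 => /eqP/(congr1 (fun p : {poly F} => p.[0])).
rewrite horner0 horner_sum big_ord_recr /= big1 => [|i _]; last first.
  rewrite hornerZ horner_exp hornerZ hornerX mulr0 expr0n subn_eq0 leqNgt.
  by rewrite ltn_ord mulr0.
rewrite subnn expr0 !hornerE => /eqP.
by rewrite -/(lead_coef r) lead_coef_eq0 (negPf r0).
Qed.

End RationalFunctions.

(* The factors are nonzero, having constant coefficient 1, so the integer      *)
(* powers with exponent -1 are genuine inverses.                               *)
Definition zeta_tilde (F : fieldType) (d : nat) (M : 'M[int]_d) :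
    {fraction {poly F}} :=
  \prod_(k < d.+1)
    tofrac (\det (1%:M - 'X *: map_mx polyC (ext_power k (map_mx intr M))))
      ^ ((-1) ^+ k.+1).

(* Main.v *)
Require Import Defs.
From HB Require Import structures.
From mathcomp Require Import all_boot all_order all_algebra.
From mathcomp Require Import perm spectral algC ring.

(** Let lambda_1, ..., lambda_d be the complex eigenvalues of M, so that D is
    their product, and write lambda_A for the product of the lambda_i with i in
    a set A of indices. The eigenvalues of the k-th exterior power of M are the
    lambda_A with #|A| = k, hence the k-th factor of the zeta function is
    P_k(z) = prod_(#|A| = k) (1 - z lambda_A), up to the exponent (-1)^(k+1).

    Since lambda_A * lambda_(~A) = D, one has
    1 - lambda_A / (D z) = 1 - 1 / (z lambda_(~A))
                         = (1 - z lambda_(~A)) / (- z lambda_(~A)),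
    and taking the product over the sets A of size k gives
    P_k (1 / (D z)) = P_(d-k)(z) / ((- z)^C(d, k) * D^C(d-1, k)):
    each lambda_i is missing from exactly C(d-1, k) sets of size k. This is
    poly_at_ext_power. In the alternating product over k, the powers of - z have
    total exponent (1 - 1)^d = 0 and those of D have total exponent (1 - 1)^(d-1),
    which is 0 unless d = 1, where it is 1; this is where B comes from. The
    remaining factors P_(d-k) make up the zeta function again, and the exponent
    (-1)^d comes from replacing k by d - k.

    The eigenvalues exist only over an algebraically closed field, which F
    need not be. The identity between P_k and P_(d-k),
    cleared of denominators, is polynomial with integer coefficients
    (ext_power_duality); so it is proved over the algebraic numbers, descends
    to the integers, and is mapped from there to F. The eigenvalues of the
    exterior powers are read off a triangular form of M (Schur), because an
    exterior power of a triangular matrix is triangular when basis vectors are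
    sorted by the sum of their indices (ext_power_trig). *)

Set Implicit Arguments.
Unset Strict Implicit.
Unset Printing Implicit Defensive.

Import Order.TTheory GRing.Theory Num.Theory.
Local Open Scope ring_scope.

(** * Increasing tuples as sets *)

Lemma incr_tuple_ltn d k (t : k.-tuple 'I_d) (a b : 'I_k) :
  t \in incr_tuples d k -> (a < b)%N -> (tnth t a < tnth t b)%N.
Proof.
rewrite inE => st ab; have x0 := tnth t a; rewrite !(tnth_nth x0).
have := @sorted_ltn_nth _ _ ltn_trans (val x0) _ st a b.
rewrite !inE !size_map !size_tuple !ltn_ord => /(_ isT isT ab).
by rewrite !(nth_map x0) ?size_tuple.
Qed.

Lemma incr_tuple_set_inj d k :
  {in incr_tuples d k &, injective (fun t : k.-tuple 'I_d => [set x in t])}.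
Proof.
move=> t u; rewrite !inE => st su /setP tu.
apply: val_inj; apply: (inj_map val_inj).
apply: (irr_sorted_eq ltn_trans ltnn st su) => x.
by apply/mapP/mapP => -[i it ->]; exists i => //; have := tu i; rewrite !inE it.
Qed.

Lemma prod_incr_tuple (R : comNzRingType) d k (t : k.-tuple 'I_d)
    (f : 'I_d -> R) :
  t \in incr_tuples d k ->
  \prod_(a < k) f (tnth t a) = \prod_(i in [set x in t]) f i.
Proof.
move=> /incr_tuple_uniq ut.
rewrite -(big_tuple _ _ t xpredT f) (big_uniq _ ut) /=.
by apply: eq_bigl => i; rewrite inE.
Qed.

Lemma image_incr_tuples d k :
  [set [set x in t] | t : k.-tuple 'I_d in incr_tuples d k] =
  [set A : {set 'I_d} | #|A| == k].
Proof.
apply/setP => A; rewrite inE; apply/imsetP/eqP => [[t it ->]|cA].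
  by rewrite cardsE (card_uniqP (incr_tuple_uniq it)) size_tuple.
have sA : size (enum A) == k by rewrite -cardE cA.
exists (Tuple sA); last by apply/setP => i; rewrite !inE mem_enum.
rewrite inE /= sorted_map /enum_mem -enumT.
apply: sorted_filter; first by move=> x y z; apply: ltn_trans.
by rewrite -sorted_map val_enum_ord iota_ltn_sorted.
Qed.

Lemma card_incr_tuples d k : #|incr_tuples d k| = 'C(d, k).
Proof.
rewrite -[d in RHS]card_ord -card_draws -image_incr_tuples.
by rewrite (card_in_imset (@incr_tuple_set_inj d k)).
Qed.

Lemma prod_incr_tuples (R : comNzRingType) d k (f : {set 'I_d} -> R) :
  \prod_(I < #|incr_tuples d k|) f [set x in enum_val I] =
  \prod_(A : {set 'I_d} | #|A| == k) f A.
Proof.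
rewrite -(big_enum_val (fun t : k.-tuple 'I_d => f [set x in t])) /=.
rewrite -(big_imset f (@incr_tuple_set_inj d k)) /=.
by rewrite image_incr_tuples; apply: eq_bigl => A; rewrite inE.
Qed.

(** * Exterior powers of triangular matrices *)

(** A permutation preserves the total weight; so if it never increases the
    weight of an index, it preserves each weight, and then only the identity
    contributes to the Leibniz formula. The weights need not be distinct, which
    spares the choice of a linear order of the indices. *)
Lemma det_weight_trig (R : comNzRingType) n (N : 'M[R]_n) (w : 'I_n -> nat) :
    (forall i j, i != j -> (w i <= w j)%N -> N i j = 0) ->
  \det N = \prod_i N i i.
Proof.
move=> N0; rewrite /determinant (bigD1 (1%g : 'S_n)) //= odd_perm1 mul1r.
rewrite [X in _ + X]big1 ?addr0 => [|s s1].
  by apply: eq_bigr => i _; rewrite perm1.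
suff [i si wi] : exists2 i, i != s i & (w i <= w (s i))%N.
  by rewrite (bigD1 i) //= N0 // mul0r mulr0.
apply/exists_inP; apply: contraR s1; rewrite negb_exists_in => /forall_inP ws.
have wle i : (w (s i) <= w i)%N.
  have [<-//|si] := eqVneq i (s i).
  by apply: ltnW; rewrite ltnNge; apply: ws.
have /eqP : (\sum_i w (s i) = \sum_i w i)%N.
  by rewrite [RHS](reindex_inj (@perm_inj _ s)).
rewrite (leqif_sum (fun i _ => conj (wle i) erefl)) => /forallP weq.
apply/eqP/permP => i; rewrite perm1; apply: contraTeq (weq i) => si.
by rewrite implyTb ltn_eqF // ltnNge; apply: ws; rewrite eq_sym.
Qed.

Section ExteriorPowerTheory.

Variable R : comNzRingType.
Implicit Types d k : nat.

(** The Cauchy-Binet formula. The I-th row of the exterior power of C is the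
    wedge product of the rows of C selected by I. *)
Lemma ext_powerM d k (A B : 'M[R]_d) :
  ext_power k (A *m B) = ext_power k A *m ext_power k B.
Proof.
have rowE (C : 'M[R]_d) I :
    row I (ext_power k C) = wedge (mxsub (incr_tuple I) id C).
  apply/rowP => J; rewrite !mxE; congr (\det _).
  by apply/matrixP => a b; rewrite !mxE.
by apply/row_matrixP => I; rewrite row_mul !rowE -wedge_mulmx mul_rowsub_mx.
Qed.

Lemma map_ext_power (S : comNzRingType) (f : {rmorphism R -> S}) d k
    (A : 'M[R]_d) :
  map_mx f (ext_power k A) = ext_power k (map_mx f A).
Proof.
apply/matrixP => I J; rewrite !mxE -det_map_mx.
by congr (\det _); apply/matrixP => a b; rewrite !mxE.
Qed.

(** A nonzero term of the minor (I, J) of T matches the entries of I with those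
    of J in such a way that no entry of J exceeds its partner. The sum of J is
    then at most that of I, and equality forces I and J to have the same
    entries. *)
Lemma ext_power_trig d k (T : 'M[R]_d) (I J : 'I_#|incr_tuples d k|) :
    is_trig_mx T -> I != J ->
    (\sum_a incr_tuple I a <= \sum_a incr_tuple J a)%N ->
  ext_power k T I J = 0.
Proof.
move=> /is_trig_mxP T0 IJ wIJ; rewrite mxE /determinant big1 // => s _.
suff [a Ia] : exists a, (incr_tuple I a < incr_tuple J (s a))%N.
  by rewrite (bigD1 a) //= mxE T0 // mul0r mulr0.
apply/existsP; apply: contraR IJ; rewrite negb_exists => /forallP JI.
have Jle a : (incr_tuple J (s a) <= incr_tuple I a)%N by rewrite leqNgt JI.
have /eqP : (\sum_a incr_tuple J (s a) = \sum_a incr_tuple I a)%N.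
  apply/eqP; rewrite eqn_leq leq_sum //= (leq_trans wIJ) //.
  by rewrite (reindex_inj (@perm_inj _ s)) leqnn.
rewrite (leqif_sum (fun a _ => conj (Jle a) erefl)) => /forallP Jeq.
have {}Jeq a : tnth (enum_val J) (s a) = tnth (enum_val I) a.
  exact/val_inj/eqP/Jeq.
apply/eqP/enum_val_inj/incr_tuple_set_inj; rewrite ?enum_valP //.
apply/setP => i; rewrite !inE; apply/tnthP/tnthP => -[a ->].
  by exists (s a).
by exists (s^-1 a)%g; rewrite -Jeq permKV.
Qed.

Lemma ext_power_trig_diag d k (T : 'M[R]_d) (I : 'I_#|incr_tuples d k|) :
    is_trig_mx T ->
  ext_power k T I I = \prod_(i in [set x in enum_val I]) T i i.
Proof.
move=> /is_trig_mxP T0; rewrite mxE det_trig; last first.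
  apply/is_trig_mxP => a b ab; rewrite mxE T0 //.
  exact: incr_tuple_ltn (enum_valP I) ab.
rewrite -(prod_incr_tuple (fun i => T i i)) ?enum_valP //.
by apply: eq_bigr => a _; rewrite mxE.
Qed.

(** The two parameters cover both determinants that the duality compares:
    a = D X, b = 1 for det (D X - L), and a = 1, b = X for det (1 - X L). *)
Lemma det_pencil_ext_power_trig (S : comNzRingType) (f : {rmorphism R -> S})
    d k (T : 'M[R]_d) (a b : S) :
    is_trig_mx T ->
  \det (a%:M - b *: map_mx f (ext_power k T)) =
  \prod_(A : {set 'I_d} | #|A| == k) (a - b * f (\prod_(i in A) T i i)).
Proof.
move=> trT; rewrite (det_weight_trig (w := fun I => \sum_a incr_tuple I a)%N).
  rewrite -prod_incr_tuples; apply: eq_bigr => I _.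
  by rewrite [in LHS]mxE mxE eqxx !mxE -ext_power_trig_diag // mxE.
move=> I J IJ wIJ; rewrite mxE mxE (negPf IJ) !mxE.
have := ext_power_trig trT IJ wIJ; rewrite mxE => ->.
by rewrite rmorph0 mulr0 subr0.
Qed.

End ExteriorPowerTheory.

(** * Duality between complementary exterior powers *)

Lemma det_ext_power_neq0 (F : fieldType) d k (P : 'M[F]_d) :
  P \in unitmx -> \det (ext_power k P) != 0.
Proof.
move=> uP; have : \det (ext_power k P) * \det (ext_power k (invmx P)) = 1.
  rewrite -det_mulmx -ext_powerM mulmxV //.
  rewrite (det_weight_trig (w := fun I => \sum_a incr_tuple I a)%N).
    apply: big1 => I _; rewrite ext_power_trig_diag ?scalar_mx_is_trig //.
    by apply: big1 => i _; rewrite mxE eqxx.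
  by move=> I J; apply: ext_power_trig; apply: scalar_mx_is_trig.
by move=> PQ; apply: contra_eq_neq PQ => ->; rewrite mul0r eq_sym oner_neq0.
Qed.

(** By Schur's theorem M is similar to a triangular matrix, whose diagonal gives
    the eigenvalues; functoriality carries the similarity over to the exterior
    powers. *)
Lemma det_pencil_ext_power (C : numClosedFieldType) d (M : 'M[C]_d) :
    (0 < d)%N ->
  exists2 lambda : 'I_d -> C, \det M = \prod_i lambda i &
    forall k (a b : {poly C}),
      \det (a%:M - b *: map_mx polyC (ext_power k M)) =
      \prod_(A : {set 'I_d} | #|A| == k)
        (a - b * (\prod_(i in A) lambda i)%:P).
Proof.
move=> d_gt0; have [P /unitarymx_unit uP trT] := Schur M d_gt0.
pose T := conjmx P M.
have PM : P *m M = T *m P by rewrite /T conjumx // mulmxKV.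
exists (fun i => T i i) => [|k a b].
  rewrite -det_trig //; apply: (@mulfI _ (\det P)).
    by rewrite -unitfE -unitmxE.
  by rewrite -det_mulmx PM det_mulmx mulrC.
rewrite -(det_pencil_ext_power_trig polyC k a b trT).
pose Q := map_mx polyC (ext_power k P).
have Q0 : \det Q != 0 by rewrite det_map_mx polyC_eq0 det_ext_power_neq0.
apply: (mulfI Q0); rewrite [RHS]mulrC -!det_mulmx; congr (\det _).
rewrite mulmxBr mulmxBl scalar_mxC -scalemxAl -scalemxAr; congr (_ - _ *: _).
by rewrite /Q -!map_mxM -!ext_powerM PM.
Qed.

(** The sets of size k that miss a given i are the subsets of size k of its
    complement. *)
Lemma prod_subsets_setC (R : comNzRingType) d k (f : 'I_d -> R) :
  \prod_(A : {set 'I_d} | #|A| == k) \prod_(i in ~: A) f i =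
  (\prod_i f i) ^+ 'C(d.-1, k).
Proof.
rewrite (exchange_big_dep xpredT) //= -prodrXl; apply: eq_bigr => i _.
rewrite prodr_const; congr (_ ^+ _).
have -> : d.-1 = #|[set~ i]| by rewrite cardsC1 card_ord.
rewrite -cards_draws; apply: eq_card => A.
by rewrite [LHS]unfold_in !inE subsetC sub1set inE andbC.
Qed.

(** Factor by factor, with D the determinant and l_A the product of the
    eigenvalues indexed by A, this is
    (D X - l_A) * l_(~A) = - D * (1 - X * l_(~A)). *)
Lemma ext_power_duality_closed (C : numClosedFieldType) d k (M : 'M[C]_d) :
    (0 < d)%N -> (k <= d)%N ->
  \det ((\det M *: 'X)%:M - map_mx polyC (ext_power k M))
    * (\det M)%:P ^+ 'C(d.-1, k) =
  (- (\det M)%:P) ^+ 'C(d, k)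
    * \det (1%:M - 'X *: map_mx polyC (ext_power (d - k) M)).
Proof.
move=> d_gt0 kd; have [lambda detM pencil] := det_pencil_ext_power M d_gt0.
have := pencil k (\det M *: 'X) 1; rewrite scale1r => ->; rewrite pencil.
(* On the right the sets of size d - k become the complements of those of
   size k. *)
rewrite [\prod_(A | _ == (d - k)%N) _](reindex_inj (@setC_inj _)) /=.
rewrite [X in _ = _ * X](eq_bigl (fun A : {set 'I_d} => #|A| == k)); last first.
  move=> A; have := cardsC A; rewrite card_ord => cA.
  by rewrite -(eqn_add2l #|A|) cA -{1}(subnK kd) addnC eqn_add2r eq_sym.
have constE x : \prod_(A : {set 'I_d} | #|A| == k) x = x ^+ 'C(d, k) :> {poly C}.
  rewrite -[d in RHS]card_ord -card_draws -prodr_const.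
  by apply: eq_bigl => A; rewrite inE.
rewrite -constE {2}detM -rmorphXn -prod_subsets_setC rmorph_prod -!big_split /=.
apply: eq_bigr => A _.
have -> : \det M = (\prod_(i in A) lambda i) * \prod_(i in ~: A) lambda i.
  rewrite detM (bigID (mem A)) /=; congr (_ * _).
  by apply: eq_bigl => i; rewrite inE.
by rewrite -mul_polyC polyCM; ring.
Qed.

(** Both sides are images of integer polynomials, and the integers embed into
    the algebraic numbers. *)
Lemma ext_power_duality (R : comNzRingType) d k (M : 'M[int]_d)
    (N := map_mx intr M : 'M[R]_d) :
    (0 < d)%N -> (k <= d)%N ->
  \det ((\det N *: 'X)%:M - map_mx polyC (ext_power k N))
    * (\det N)%:P ^+ 'C(d.-1, k) =
  (- (\det N)%:P) ^+ 'C(d, k)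
    * \det (1%:M - 'X *: map_mx polyC (ext_power (d - k) N)).
Proof.
move=> d_gt0 kd.
pose lhs (S : comNzRingType) (U : 'M[S]_d) : {poly S} :=
  \det ((\det U *: 'X)%:M - map_mx polyC (ext_power k U))
    * (\det U)%:P ^+ 'C(d.-1, k).
pose rhs (S : comNzRingType) (U : 'M[S]_d) : {poly S} :=
  (- (\det U)%:P) ^+ 'C(d, k)
    * \det (1%:M - 'X *: map_mx polyC (ext_power (d - k) U)).
have map_ext (S : comNzRingType) j :
    map_mx (map_poly intr) (map_mx polyC (ext_power j M)) =
    map_mx polyC (ext_power j (map_mx intr M)) :> 'M[{poly S}]_#|_|.
  by rewrite -map_ext_power; apply/matrixP => I J; rewrite !mxE map_polyC.
have map_lhs (S : comNzRingType) :
    map_poly intr (lhs int M) = lhs S (map_mx intr M).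
  rewrite /lhs rmorphM rmorphXn /= map_polyC -det_map_mx map_mxB map_scalar_mx.
  by rewrite -!mul_polyC rmorphM /= map_polyC map_polyX map_ext !det_map_mx.
have map_rhs (S : comNzRingType) :
    map_poly intr (rhs int M) = rhs S (map_mx intr M).
  rewrite /rhs rmorphM rmorphXn rmorphN /= map_polyC -det_map_mx map_mxB.
  rewrite map_mxZ map_scalar_mx rmorph1 /= map_polyX map_ext.
  by rewrite !det_map_mx.
suff /(congr1 (map_poly (intr : int -> R))) : lhs int M = rhs int M.
  by rewrite map_lhs map_rhs.
apply: (map_inj_poly (f := intr : int -> algC) intr_inj (mulr0z _)).
by rewrite map_lhs map_rhs; apply: ext_power_duality_closed.
Qed.

(** * Substitution in rational functions *)

Section Substitution.

Variables (F : fieldType) (g : {fraction {poly F}}).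

Lemma poly_at1 : poly_at 1 g = 1.
Proof. by rewrite /poly_at rmorph1 hornerE. Qed.

Lemma poly_at_det n (N : 'M[{poly F}]_n) :
  poly_at (\det N) g = \det (map_mx (fun p => poly_at p g) N).
Proof.
rewrite -[poly_at _ _]/((horner_eval g \o map_poly (@ratconst F)) _).
rewrite -det_map_mx.
by congr (\det _); apply/matrixP => i j; rewrite !mxE.
Qed.

Hypothesis g_trans : forall r : {poly F}, r != 0 -> poly_at r g != 0.

Lemma ratfun_compM f h :
  ratfun_comp (f * h) g = ratfun_comp f g * ratfun_comp h g.
Proof.
rewrite (tofrac_repr f) (tofrac_repr h).
have := denom_ratioP (repr h); have := denom_ratioP (repr f).
move: (\n_(repr f)) (\d_(repr f)) (\n_(repr h)) (\d_(repr h)) => p q r s q0 s0.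
rewrite mulf_div -!tofracM !ratfun_comp_frac ?mulf_neq0 //.
by rewrite !poly_atM mulf_div.
Qed.

Lemma ratfun_comp1 : ratfun_comp 1 g = 1.
Proof.
rewrite -[1 in LHS](divff (oner_neq0 _)) -tofrac1.
by rewrite ratfun_comp_frac ?oner_neq0 // poly_at1 divr1.
Qed.

Lemma ratfun_comp_sign (p : {poly F}) n : p != 0 ->
  ratfun_comp (tofrac p ^ ((-1) ^+ n)) g = poly_at p g ^ ((-1) ^+ n).
Proof.
move=> p0; rewrite -signr_odd.
case: (odd n); rewrite ?expr0 ?expr1 ?exprN1 ?expr1z.
  by rewrite -[_^-1]mul1r -tofrac1 ratfun_comp_frac // poly_at1 mul1r.
rewrite -[tofrac p]divr1 -tofrac1.
by rewrite ratfun_comp_frac ?oner_neq0 // poly_at1 divr1.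
Qed.

End Substitution.

Lemma det_1_sub_X_neq0 (F : fieldType) n (L : 'M[F]_n) :
  \det (1%:M - 'X *: map_mx polyC L) != 0.
Proof.
apply/eqP => /(congr1 (horner_eval 0)); rewrite -det_map_mx map_mxB map_mxZ.
rewrite map_scalar_mx rmorph1 rmorph0 /= [horner_eval 0 'X]hornerX.
by rewrite scale0r subr0 det1; apply/eqP; rewrite oner_eq0.
Qed.

(** Evaluation at 1 / (D z), followed by multiplication of each row by D z, turns
    1 - X L into D z - L. *)
Lemma tofrac_det_pencil (F : fieldType) n (D : F) (L : 'M[F]_n)
    (u := ratconst D * ratvar F) : D != 0 ->
  tofrac (\det ((D *: 'X)%:M - map_mx polyC L)) =
  u ^+ n * poly_at (\det (1%:M - 'X *: map_mx polyC L)) (1 / u).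
Proof.
move=> D0; have DX : tofrac (D *: 'X) = u by rewrite -mul_polyC tofracM.
have {D0}: u != 0 by rewrite -DX tofrac_eq0 scaler_eq0 negb_or D0 polyX_eq0.
move: (u) DX => {u} u DX u0.
rewrite poly_at_det -det_map_mx -detZ; congr (\det _).
apply/matrixP => i j; rewrite !mxE /poly_at.
rewrite [LHS]rmorphB rmorphMn /= DX -/(ratconst _).
rewrite rmorphB rmorphM rmorph_nat /= map_polyX map_polyC hornerD hornerMn.
rewrite !hornerE /= mulrBr.
by rewrite (mulVKf u0) mulrnAr mulr1.
Qed.

(** The functional equation of a single factor: ext_power_duality read in the
    field of rational functions, the powers of D z and - D being cancelled. *)
Lemma poly_at_ext_power (F : fieldType) d k (M : 'M[int]_d)
    (N := map_mx intr M : 'M[F]_d) (c := ratconst (\det N)) (z := ratvar F) :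
    (0 < d)%N -> (k <= d)%N -> \det N != 0 ->
  poly_at (\det (1%:M - 'X *: map_mx polyC (ext_power k N))) (1 / (c * z)) =
  tofrac (\det (1%:M - 'X *: map_mx polyC (ext_power (d - k) N)))
    / ((- z) ^+ 'C(d, k) * c ^+ 'C(d.-1, k)).
Proof.
move=> d_gt0 kd N0.
have solve_p (K : fieldType) (x y p q : K) m n : x != 0 -> y != 0 ->
    (x * y) ^+ m * p * x ^+ n = (- x) ^+ m * q ->
    p = q / ((- y) ^+ m * x ^+ n).
  move=> x0 y0 E; have x_n0 l : x ^+ l != 0 by rewrite expf_neq0.
  have y_m0 : (- y) ^+ m != 0 by rewrite expf_neq0 ?oppr_eq0.
  apply: (canRL (mulfK _)); first by rewrite mulf_neq0.
  apply: (@mulfI _ ((- x) ^+ m)); first by rewrite expf_neq0 ?oppr_eq0.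
  by rewrite -E -[x * y]mulrNN exprMn; ring.
apply: solve_p; first by rewrite tofrac_eq0 polyC_eq0.
  by rewrite tofrac_eq0 polyX_eq0.
have := congr1 (@tofrac _) (ext_power_duality F M d_gt0 kd).
rewrite -/N !tofracM !tofracXn tofracN -/(ratconst _) -/c.
rewrite tofrac_det_pencil // -/c -/z.
by move: (poly_at _ _) (tofrac _) => p q; rewrite card_incr_tuples.
Qed.

(** * The functional equation *)

Lemma prod_alternating_binomial (K : fieldType) (x : K) n : x != 0 ->
  \prod_(k < n.+1) (x ^+ 'C(n, k)) ^ ((-1) ^+ k) = x ^+ (n == 0)%N.
Proof.
move=> x0.
transitivity (x ^ (\sum_(k < n.+1) 'C(n, k)%:Z * (-1) ^+ k)).
  rewrite (big_morph (exprz x) (fun a b => expfzDr a b x0) (expr0z x)).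
  by apply: eq_bigr => k _; rewrite -exprz_exp -exprnP.
have -> : \sum_(k < n.+1) 'C(n, k)%:Z * (-1) ^+ k = (1 + -1) ^+ n :> int.
  rewrite exprDn; apply: eq_bigr => k _.
  by rewrite expr1n mul1r -mulr_natl natz.
by rewrite subrr expr0n; case: n.
Qed.

(** The numerators reassemble, with exponent (-1)^d, by reindexing k as d - k;
    the denominators contribute only if d = 1. *)
Lemma prod_alternating_complement (K : fieldType) d (p : nat -> K) (x c : K) :
    (0 < d)%N -> x != 0 -> c != 0 ->
  \prod_(k < d.+1)
      (p (d - k)%N / (x ^+ 'C(d, k) * c ^+ 'C(d.-1, k))) ^ ((-1) ^+ k.+1) =
  c ^+ (d == 1)%N * (\prod_(k < d.+1) p k ^ ((-1) ^+ k.+1)) ^ ((-1) ^+ d).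
Proof.
case: d => // n _ x0 c0; set d := n.+1; pose s k : int := (-1) ^+ k.
transitivity (\prod_(k < d.+1) (p (d - k)%N ^ s k.+1 *
    ((x ^+ 'C(d, k)) ^ s k * (c ^+ 'C(d.-1, k)) ^ s k))).
  apply: eq_bigr => k _; rewrite expfzMl exprz_inv; congr (_ * _).
  by rewrite exprS mulN1r opprK expfzMl.
rewrite 2!big_split /= prod_alternating_binomial // mul1r mulrC.
congr (_ * _).
  (* The index k = d contributes C(n, n+1) = 0; the others give the full
     alternating sum of the binomial coefficients of n. *)
  by rewrite big_ord_recr /= bin_small // exp1rz mulr1 prod_alternating_binomial.
rewrite (big_morph (fun y => y ^ s d) (fun y z => expfzMl y z _) (exp1rz K (s d))).
rewrite (reindex_inj rev_ord_inj) /=; apply: eq_bigr => k _.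
have kd : (k <= d)%N by rewrite -ltnS.
rewrite subSS subKn // exprz_exp; congr (_ ^ _).
(* The signs agree because d - k and k + d have the same parity. *)
by rewrite /s -exprD addSn exprS [RHS]exprS; congr (_ * _);
  rewrite -[LHS]signr_odd -[RHS]signr_odd oddB // oddD addbC.
Qed.

Theorem lemma1 (F : numFieldType) (d : nat) (M : 'M[int]_d)
    (d_ge1 : (1 <= d)%N) (detM_neq0 : \det M != 0) :
  let D : F := (\det M)%:~R in
  let B : F := if d == 1%N then D else 1 in
  ratfun_comp (zeta_tilde F M) (1 / (ratconst D * ratvar F)) =
    ratconst B * zeta_tilde F M ^ ((-1) ^+ d).
Proof.
move=> D B.
pose N := map_mx intr M : 'M[F]_d; pose g := 1 / (ratconst D * ratvar F).
pose P k := \det (1%:M - 'X *: map_mx polyC (ext_power k N)).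
have detN : \det N = D by rewrite det_map_mx.
have D0 : D != 0 by rewrite intr_eq0.
have g_trans r : r != 0 -> poly_at r g != 0 by exact: poly_at_inv_var.
have P_at (k : 'I_d.+1) : poly_at (P k) g = tofrac (P (d - k)%N)
    / ((- ratvar F) ^+ 'C(d, k) * ratconst D ^+ 'C(d.-1, k)).
  have /(poly_at_ext_power d_ge1) : (k <= d)%N by rewrite -ltnS.
  by move=> /(_ F M); rewrite -/N detN; apply.
transitivity (\prod_(k < d.+1) poly_at (P k) g ^ ((-1) ^+ k.+1)).
  rewrite /zeta_tilde -/N -/g.
  rewrite (big_morph _ (ratfun_compM g_trans) (ratfun_comp1 g_trans)).
  by apply: eq_bigr => k _; rewrite ratfun_comp_sign ?det_1_sub_X_neq0.
under eq_bigr => k _ do rewrite P_at.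
rewrite (prod_alternating_complement (fun k => tofrac (P k))) //; last first.
- by rewrite tofrac_eq0 polyC_eq0.
- by rewrite oppr_eq0 tofrac_eq0 polyX_eq0.
by congr (_ * _); rewrite /B; case: (d == 1%N); rewrite ?expr1 // rmorph1.
Qed.
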